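(* Let $R$ be a ring, let $(\mathcal{L},\mathcal{A})$ be a complete duality pair over $R$, and let $G$ be a strongly Gorenstein $(\mathcal{L},\mathcal{A})$-projective left $R$-module. Let $G^{\perp}=\{N\in R\text{-Mod}\mid\mathrm{Ext}^1_R(G,N)=0\}$ and ${}^{\perp}(G^{\perp})=\{B\in R\text{-Mod}\mid\mathrm{Ext}^1_R(B,N)=0\ \forall N\in G^{\perp}\}$. Then the following statements hold. (1) $G^{\perp}$ is a thick subcategory of $R$-Mod. (2) $({}^{\perp}(G^{\perp}),G^{\perp})$ is a projective cotorsion pair, cogenerated by a set.
   Context: $R$ is an associative ring with identity; modules are left $R$-modules unless stated otherwise. For a module $M$, $M^+=\mathrm{Hom}_{\mathbb{Z}}(M,\mathbb{Q}/\mathbb{Z})$ is its character module (on the opposite side). Duality pairs: a duality pair over $R$ is a pair $(\mathcal{L},\mathcal{A})$, with $\mathcal{L}$ a class of left (resp. right) $R$-modules and $\mathcal{A}$ a class of right (resp. left) $R$-modules, such that $L\in\mathcal{L}$ if and only if $L^+\in\mathcal{A}$, and $\mathcal{A}$ is closed under direct summands and finite direct sums. With $\mathcal{L}$ a class of left modules, $(\mathcal{L},\mathcal{A})$ is perfect if $\mathcal{L}$ contains ${}_RR$ and is closed under coproducts and extensions. $(\mathcal{L},\mathcal{A})$ is complete if it is a perfect duality pair and $(\mathcal{A},\mathcal{L})$ is also a duality pair. Classes of modules are closed under isomorphism. Here $\mathcal{L}$ consists of left modules and $\mathcal{A}$ of right modules. A sequence is $\mathrm{Hom}_R(-,\mathcal{L})$-exact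 if it remains exact after applying $\mathrm{Hom}_R(-,L)$ for every $L\in\mathcal{L}$. A left $R$-module $M$ is strongly Gorenstein $(\mathcal{L},\mathcal{A})$-projective if there is a $\mathrm{Hom}_R(-,\mathcal{L})$-exact exact sequence $\cdots\xrightarrow{f}P\xrightarrow{f}P\xrightarrow{f}P\xrightarrow{f}\cdots$ (the same module and the same map in every degree) with $P$ projective such that $M\cong\mathrm{Ker} f$. Thick: closed under direct summands, extensions, kernels of epimorphisms and cokernels of monomorphisms (between members of the class). A cotorsion pair is a pair $(\mathcal{X},\mathcal{Y})$ of classes with $\mathcal{X}^{\perp}=\mathcal{Y}$ and $\mathcal{X}={}^{\perp}\mathcal{Y}$ (orthogonals with respect to $\mathrm{Ext}^1$). It is complete if every object $A$ admits exact sequences $0\to Y\to X\to A\to0$ and $0\to A\to Y'\to X'\to0$ with $X,X'\in\mathcal{X}$ and $Y,Y'\in\mathcal{Y}$. It is cogenerated by a set $\mathcal{S}$ if $\mathcal{Y}=\mathcal{S}^{\perp}$. A complete cotorsion pair $(\mathcal{X},\mathcal{Y})$ is projective if $\mathcal{Y}$ is thick and $\mathcal{X}\cap\mathcal{Y}$ is the class of projective objects. *)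

(* Defs.v *)
From HB Require Import structures.
From mathcomp Require Import all_boot all_order all_algebra ring_quotient.
From mathcomp Require Import boolp functions.

Set Implicit Arguments.
Unset Strict Implicit.
Unset Printing Implicit Defensive.

Import GRing.Theory.

Local Open Scope ring_scope.

(* Left R-modules are [lmodType R] and right R-modules are [lmodType R^c].
   All carriers live in the universe [GRing.Lmodule.axioms_.u0], which therefore
   plays the role of the universe of (small) sets: the index types of
   coproducts and of generating sets are taken in that same universe. *)

(* [Num.int_num_subdef] is the predicate underlying the qualifier [Num.int]. *)
Definition QmodZ : zmodType :=
  Quotient.quot (GRing.ZmodClosed.clone rat (@Num.int_num_subdef rat) _).

Section CharacterGroup.
Variable M : zmodType.

Definition additive_fun : pred (M -> QmodZ) := fun f => `[< zmod_morphism f >].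

Fact additive_fun_closed : zmod_closed additive_fun.
Proof.
split=> [|f g /asboolP fB /asboolP gB]; apply/asboolP => x y.
  exact: esym (subr0 _).
transitivity (f (x - y) - g (x - y)) => //.
by rewrite fB gB !opprD !opprK addrACA.
Qed.

HB.instance Definition _ :=
  GRing.isZmodClosed.Build (M -> QmodZ) additive_fun additive_fun_closed.

Record character : Type :=
  Character { character_fun :> M -> QmodZ; _ : character_fun \in additive_fun }.

HB.instance Definition _ := [isSub for character_fun].
HB.instance Definition _ := [Choice of character by <:].
HB.instance Definition _ := [SubChoice_isSubZmodule of character by <:].

Lemma characterB (f : character) : zmod_morphism f.
Proof. by apply/asboolP; exact: (valP f). Qed.

HB.instance Definition _ (f : character) :=
  GRing.isZmodMorphism.Build M QmodZ f (characterB f).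

End CharacterGroup.

(* M^+ for a left module M: the right module with (f r)(x) = f (r x). *)
Section CharacterOfLeft.
Variables (R : pzRingType) (M : lmodType R).

Definition char_left : Type := character M.

HB.instance Definition _ := GRing.Zmodule.on char_left.

Fact char_left_scale_subproof (r : R^c) (f : char_left) :
  (fun x : M => f ((r : R) *: x)) \in @additive_fun M.
Proof. by apply/asboolP => x y; rewrite scalerBr (characterB f). Qed.

Definition char_left_scale (r : R^c) (f : char_left) : char_left :=
  Character (char_left_scale_subproof r f).

Fact char_left_scaleA (a b : R^c) (f : char_left) :
  char_left_scale a (char_left_scale b f) = char_left_scale (a * b) f.
Proof. by apply: val_inj; apply: funext => x /=; rewrite scalerA. Qed.

Fact char_left_scale1 : left_id 1 char_left_scale.
Proof. by move=> f; apply: val_inj; apply: funext => x /=; rewrite scale1r. Qed.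

Fact char_left_scaleDr : right_distributive char_left_scale +%R.
Proof. by move=> a f g; apply: val_inj; apply: funext. Qed.

Fact char_left_scaleDl (f : char_left) :
  {morph char_left_scale^~ f : a b / a + b}.
Proof.
move=> a b; apply: val_inj; apply: funext => x /=.
by rewrite scalerDl raddfD.
Qed.

HB.instance Definition _ := GRing.Zmodule_isLmodule.Build R^c char_left
  char_left_scaleA char_left_scale1 char_left_scaleDr char_left_scaleDl.

End CharacterOfLeft.

(* M^+ for a right module M: the left module with (r f)(x) = f (x r). *)
Section CharacterOfRight.
Variables (R : pzRingType) (M : lmodType R^c).

Definition char_right : Type := character M.

HB.instance Definition _ := GRing.Zmodule.on char_right.

Fact char_right_scale_subproof (r : R) (f : char_right) :
  (fun x : M => f ((r : R^c) *: x)) \in @additive_fun M.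
Proof. by apply/asboolP => x y; rewrite scalerBr (characterB f). Qed.

Definition char_right_scale (r : R) (f : char_right) : char_right :=
  Character (char_right_scale_subproof r f).

Fact char_right_scaleA (a b : R) (f : char_right) :
  char_right_scale a (char_right_scale b f) = char_right_scale (a * b) f.
Proof. by apply: val_inj; apply: funext => x /=; rewrite scalerA. Qed.

Fact char_right_scale1 : left_id 1 char_right_scale.
Proof. by move=> f; apply: val_inj; apply: funext => x /=; rewrite scale1r. Qed.

Fact char_right_scaleDr : right_distributive char_right_scale +%R.
Proof. by move=> a f g; apply: val_inj; apply: funext. Qed.

Fact char_right_scaleDl (f : char_right) :
  {morph char_right_scale^~ f : a b / a + b}.
Proof.
move=> a b; apply: val_inj; apply: funext => x /=.
by rewrite scalerDl raddfD.
Qed.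

HB.instance Definition _ := GRing.Zmodule_isLmodule.Build R char_right
  char_right_scaleA char_right_scale1 char_right_scaleDr char_right_scaleDl.

End CharacterOfRight.

Section Modules.
Variable R : pzRingType.

Definition module_iso (M N : lmodType R) : Prop :=
  exists f : {linear M -> N}, bijective f.

Definition surj (A B : Type) (f : A -> B) : Prop := forall y, exists x, f x = y.

Definition exact_at (A B C : lmodType R)
    (f : {linear A -> B}) (g : {linear B -> C}) : Prop :=
  forall y, g y = 0 <-> exists x, f x = y.

Definition short_exact (A B C : lmodType R)
    (f : {linear A -> B}) (g : {linear B -> C}) : Prop :=
  [/\ injective f, exact_at f g & surj g].

(* Exactness at Hom(B, N) of Hom(C, N) -> Hom(B, N) -> Hom(A, N). *)
Definition hom_exact_at (A B C : lmodType R)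
    (f : {linear A -> B}) (g : {linear B -> C}) (N : lmodType R) : Prop :=
  forall k : {linear B -> N},
    (forall x, k (f x) = 0) <->
    exists h : {linear C -> N}, forall y, h (g y) = k y.

Definition projective (P : lmodType R) : Prop :=
  forall (M N : lmodType R) (g : {linear M -> N}) (f : {linear P -> N}),
    surj g -> exists h : {linear P -> M}, forall x, g (h x) = f x.

Definition is_coproduct (I : Type) (F : I -> lmodType R) (M : lmodType R)
    (inj : forall i, {linear F i -> M}) : Prop :=
  forall (N : lmodType R) (g : forall i, {linear F i -> N}),
    exists2 h : {linear M -> N},
      forall i x, h (inj i x) = g i x &
      forall h' : {linear M -> N}, (forall i x, h' (inj i x) = g i x) -> h' =1 h.

Record projective_resolution (M : lmodType R) := ProjectiveResolution {
  pr_obj :> nat -> lmodType R;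
  pr_diff : forall n, {linear pr_obj n.+1 -> pr_obj n};
  pr_aug : {linear pr_obj 0 -> M};
  pr_projective : forall n, projective (pr_obj n);
  pr_aug_surj : surj pr_aug;
  pr_aug_exact : exact_at (pr_diff 0) pr_aug;
  pr_diff_exact : forall n, exact_at (pr_diff n.+1) (pr_diff n)
}.

(* Ext^1_R(M, N) = 0, i.e. the first cohomology group of Hom(P, N) vanishes for
   a projective resolution P of M. Projective resolutions exist and this does
   not depend on the one chosen, so quantifying over all of them is harmless. *)
Definition Ext1_eq0 (M N : lmodType R) : Prop :=
  forall (P : projective_resolution M) (g : {linear P 1 -> N}),
    (forall x, g (pr_diff P 1 x) = 0) ->
    exists h : {linear P 0 -> N}, forall x, h (pr_diff P 0 x) = g x.

Implicit Types X Y : lmodType R -> Prop.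

Definition iso_closed X : Prop :=
  forall M N, module_iso M N -> X M -> X N.

Definition summand_closed X : Prop :=
  forall M A B : lmodType R, module_iso M (A * B)%type -> X M -> X A.

Definition coproduct_closed_over (I : Type@{GRing.Lmodule.axioms_.u0}) X : Prop :=
  forall (F : I -> lmodType R) (M : lmodType R) (inj : forall i, {linear F i -> M}),
    is_coproduct inj -> (forall i, X (F i)) -> X M.

Definition coproduct_closed X : Prop :=
  forall I : Type@{GRing.Lmodule.axioms_.u0}, coproduct_closed_over I X.

Definition finite_sum_closed X : Prop :=
  forall n : nat, coproduct_closed_over 'I_n X.

Definition extension_closed X : Prop :=
  forall (A B C : lmodType R) (f : {linear A -> B}) (g : {linear B -> C}),
    short_exact f g -> X A -> X C -> X B.

Definition epi_kernel_closed X : Prop :=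
  forall (A B C : lmodType R) (f : {linear A -> B}) (g : {linear B -> C}),
    short_exact f g -> X B -> X C -> X A.

Definition mono_cokernel_closed X : Prop :=
  forall (A B C : lmodType R) (f : {linear A -> B}) (g : {linear B -> C}),
    short_exact f g -> X A -> X B -> X C.

Definition thick X : Prop :=
  [/\ summand_closed X, extension_closed X, epi_kernel_closed X
    & mono_cokernel_closed X].

Definition right_orth X : lmodType R -> Prop :=
  fun N => forall M, X M -> Ext1_eq0 M N.

Definition left_orth Y : lmodType R -> Prop :=
  fun M => forall N, Y N -> Ext1_eq0 M N.

Definition orth1 (G : lmodType R) : lmodType R -> Prop := Ext1_eq0 G.

Definition cotorsion_pair X Y : Prop :=
  (forall N, right_orth X N <-> Y N) /\ (forall M, X M <-> left_orth Y M).

Definition complete_cotorsion_pair X Y : Prop :=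
  cotorsion_pair X Y /\
  forall A : lmodType R,
    (exists (Y0 X0 : lmodType R) (f : {linear Y0 -> X0}) (g : {linear X0 -> A}),
       [/\ short_exact f g, X X0 & Y Y0]) /\
    (exists (Y1 X1 : lmodType R) (f : {linear A -> Y1}) (g : {linear Y1 -> X1}),
       [/\ short_exact f g, X X1 & Y Y1]).

Definition projective_cotorsion_pair X Y : Prop :=
  [/\ complete_cotorsion_pair X Y, thick Y
    & forall M, X M /\ Y M <-> projective M].

Definition cogenerated_by_set X Y : Prop :=
  cotorsion_pair X Y /\
  exists (I : Type@{GRing.Lmodule.axioms_.u0}) (S : I -> lmodType R),
    forall N, Y N <-> forall i, Ext1_eq0 (S i) N.

(* The isomorphism M = Ker f is given as an injection M -> P with image Ker f. *)
Definition strongly_Gorenstein_projective (L : lmodType R -> Prop)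
    (M : lmodType R) : Prop :=
  exists (P : lmodType R) (f : {linear P -> P}),
    [/\ projective P, exact_at f f, forall N, L N -> hom_exact_at f f N
      & exists i : {linear M -> P}, injective i /\ exact_at i f].

End Modules.

(* [chr] is the character-module functor; it is instantiated by
   [char_left : R-Mod -> Mod-R] and by [char_right : Mod-R -> R-Mod]. *)
Definition duality_pair (S T : pzRingType) (chr : lmodType S -> lmodType T)
    (L : lmodType S -> Prop) (A : lmodType T -> Prop) : Prop :=
  [/\ iso_closed L, iso_closed A, forall M, L M <-> A (chr M),
      summand_closed A & finite_sum_closed A].

Definition perfect_duality_pair (R : pzRingType)
    (L : lmodType R -> Prop) (A : lmodType R^c -> Prop) : Prop :=
  [/\ duality_pair (fun M => char_left M : lmodType R^c) L A,
      L R^o, coproduct_closed L & extension_closed L].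

Definition complete_duality_pair (R : pzRingType)
    (L : lmodType R -> Prop) (A : lmodType R^c -> Prop) : Prop :=
  perfect_duality_pair L A /\
  duality_pair (fun M => char_right M : lmodType R) A L.

(* Main.v *)
(** By definition there is a short exact sequence 0 -> G -i-> P -p-> G -> 0 with P
    projective, so Ext^1(G, N) vanishes iff every map G -> N extends along i, and
    Ext^2(G, -) = Ext^1(G, -); thickness of G^perp is then a diagram chase.
    Projectives lie in L, being summands of coproducts of copies of R, hence in
    G^perp because the defining complex is Hom(-, L)-exact.

    Completeness needs no transfinite induction.  Given A, let Y be the free algebra
    on A with an operation extending every map G -> Y along i: its elements are
    infinitary terms, identified when they agree in every such algebra.  Then Y lies
    in G^perp.  The map A -> Y is injective because A is separated by maps to
    Hom_Z(R, Q/Z), which carries such an operation.  For N in G^perp, the pullback to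
    Y of an extension of Y/A by N carries an operation strictly above that of Y, so
    freeness of Y splits it compatibly with A: thus Y/A is in the left orthogonal of
    G^perp.  Special precovers follow by Salce's pushout trick. *)
Require Import Defs.
From HB Require Import structures.
From mathcomp Require Import all_boot all_order all_algebra.
From mathcomp Require Import ring_quotient boolp classical_sets.

Set Implicit Arguments.
Unset Strict Implicit.
Unset Printing Implicit Defensive.

Import GRing.Theory.
Local Open Scope ring_scope.

(** * Characters *)

Definition char_of (M : zmodType) (f : M -> QmodZ) (fP : zmod_morphism f) : character M :=
  Character (asboolT fP : f \in @additive_fun M).

Lemma QmodZ_pi : exists f : {additive rat -> QmodZ},
  surj f /\ forall x, f x = 0 <-> exists n : int, x = n%:~R.
Proof.
pose I := GRing.ZmodClosed.clone rat (@Num.int_num_subdef rat) _.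
pose f : {additive rat -> QmodZ} := \pi_(Quotient.quot I)%qT.
exists f; split=> [y|x]; first by exists (repr y); rewrite /f /= reprK.
have -> : f x = 0 <-> (x - 0) \in I.
  by rewrite (Quotient.idealrBE I) -(raddf0 f); split=> /eqP.
by rewrite subr0; split=> [/Num.Theory.intrP|[n ->]] //; exact: Num.Theory.intr_int.
Qed.

(** Since [k] exceeds 1, the class of [1/k] is a nonzero [k]-torsion element, and it can be added
    when the obvious root is zero. *)
Lemma QmodZ_divide (c : QmodZ) (k : nat) : (1 < k)%N ->
  exists2 d : QmodZ, d != 0 & d *+ k = c.
Proof.
move=> k_gt1; have [f [fS f0]] := QmodZ_pi; have [q <-] := fS c.
have kn0 : k%:R != 0 :> rat by rewrite Num.Theory.pnatr_eq0 -lt0n ltnW.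
have fk x : f (x / k%:R) *+ k = f x.
  by rewrite -raddfMn -[_ *+ k]mulr_natr divfK.
have f1 : f (1 / k%:R) != 0.
  apply/eqP => /f0[n /(congr1 ( *%R^~ k%:R))].
  rewrite divfK// pmulrn -intrM => /(@intr_inj rat 1)/(congr1 absz).
  by rewrite abszM /= => /esym/eqP; rewrite muln_eq1 => /andP[_ /eqP k1]; rewrite k1 in k_gt1.
have [fq0|fq0] := eqVneq (f (q / k%:R)) 0; last by exists (f (q / k%:R)).
exists (f ((q + 1) / k%:R)); first by rewrite mulrDl raddfD fq0 add0r.
by rewrite fk raddfD (_ : f 1 = 0) ?addr0//; apply/f0; exists 1.
Qed.

Section CharacterExtension.
Variable M : zmodType.

(** The graph of a homomorphism defined on a subgroup of [M]; as sets, such graphs are ordered by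
    inclusion for Zorn's lemma. *)
Definition partial_character (S : set (M * QmodZ)) : Prop :=
  [/\ S (0, 0), forall x y x' y', S (x, y) -> S (x', y') -> S (x - x', y - y')
    & forall d, S (0, d) -> d = 0].

Lemma partial_character_step (S : set (M * QmodZ)) (b : M) :
  partial_character S -> (forall d, ~ S (b, d)) ->
  exists (S' : set (M * QmodZ)) (d : QmodZ),
    [/\ partial_character S', (S `<=` S')%classic, S' (b, d) & d != 0].
Proof.
move=> [S0 SB Sf] bS.
have SN x y : S (x, y) -> S (- x, - y).
  by move=> Su; rewrite -[- x]add0r -[- y]add0r; exact: SB.
have SD x y x' y' : S (x, y) -> S (x', y') -> S (x + x', y + y').
  by move=> Su /SN Sv; rewrite -[x']opprK -[y']opprK; exact: SB.
have SMn x y n : S (x, y) -> S (x *+ n, y *+ n).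
  by move=> Su; elim: n => // n IH; rewrite !mulrS; exact: SD.
have SMz x y (n : int) : S (x, y) -> S (x *~ n, y *~ n).
  by move=> Su; case: n => n; [exact: SMn|exact/SN/SMn].
have [d d0 dP] : exists2 d : QmodZ, d != 0 & forall (n : int) e, S (b *~ n, e) -> e = d *~ n.
  (* [d] must be compatible with the least positive multiple of [b] in the domain of
     [S], if there is one; it is unconstrained otherwise. *)
  pose K : pred nat := fun k => `[< (0 < k)%N /\ exists c, S (b *+ k, c) >].
  have [exK|nk] := EM (exists k, K k).
    case: (ex_minnP exK) => k /asboolP[k_gt0 [c bc]] kmin.
    have k_gt1 : (1 < k)%N.
      rewrite ltn_neqAle k_gt0 andbT; apply/eqP => k1.
      by rewrite -k1 mulr1n in bc; exact: bS bc.
    have [d d0 dk] := QmodZ_divide c k_gt1; exists d => // n e Sne.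
    have kz0 : k%:Z != 0 by rewrite -lt0n.
    have /gez0_abs rE := modz_ge0 n kz0; set r := absz _ in rE.
    have nE : n = (n %/ k)%Z * k + r by rewrite rE -divz_eq.
    (* The remainder of [n] modulo [k] also gives a multiple of [b] in the domain, so minimality of
       [k] forces it to be 0. *)
    have Sr : S (b *+ r, e - c *~ (n %/ k)%Z).
      have -> : b *+ r = b *~ n - b *+ k *~ (n %/ k)%Z.
        by rewrite {1}nE !pmulrn mulrzDr [_ * _]mulrC mulrzA addrAC subrr add0r.
      by apply: SB => //; exact: SMz.
    have r0 : r = 0%N.
      apply/eqP; rewrite -leqn0 leqNgt; apply/negP => r_gt0.
      have := kmin r (asboolT (conj r_gt0 (ex_intro _ _ Sr))).
      by rewrite leqNgt -ltz_nat rE ltz_pmod// ltz_nat.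
    move: Sr; rewrite r0 mulr0n => /Sf/eqP; rewrite subr_eq0 => /eqP ->.
    by rewrite -dk [in RHS]nE r0 addr0 pmulrn -mulrzA mulrC.
  have [d d0 _] := QmodZ_divide 0 (ltnSn 1); exists d => // n e Sne.
  have n0 : n = 0.
    apply: contrapT => /eqP n0; apply: nk; exists `|n|%N; apply/asboolP.
    split; first by rewrite absz_gt0.
    case: n Sne n0 => n Sne _; first by exists e.
    by exists (- e); have := SN _ _ Sne; rewrite opprK.
  by rewrite n0 in Sne *; exact: Sf.
(* The sum of [S] and the subgroup generated by [(b, d)]. *)
exists (fun u => exists n : int, S (u.1 - b *~ n, u.2 - d *~ n)), d; split=> //.
- split=> [|x y x' y' [m um] [n vn]|e [n] /=].
  + by exists 0; rewrite /= !mulr0z !subr0.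
  + have subACA (V : zmodType) (s t s' t' : V) : s - s' - (t - t') = s - t - (s' - t').
      by rewrite opprD addrACA -opprD.
    by exists (m - n); rewrite /= !mulrzBr (subACA _ x) (subACA _ y); exact: SB.
  + move=> /SN; rewrite sub0r opprK opprB => /dP/eqP.
    by rewrite subr_eq addrC -subr_eq subrr eq_sym => /eqP.
- by move=> [x y] Su; exists 0; rewrite /= !mulr0z !subr0.
- by exists 1; rewrite /= !mulr1z !subrr.
Qed.

Lemma partial_character_total (S : set (M * QmodZ)) :
  partial_character S ->
  exists chi : character M, forall x d, S (x, d) -> chi x = d.
Proof.
move=> pS.
pose good A := (S `<=` A)%classic /\ partial_character A.
(* [Zorn_bigcup] includes the empty chain, so the empty set has to satisfy [P]. *)
pose P A := forall u : M * QmodZ, A u -> good A.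
have [F FP Ftot|A [PA Amax]] := @Zorn_bigcup _ P.
  move=> u [X FX Xu]; split.
    by move=> v Sv; exists X => //; apply: (FP _ FX u Xu).1.
  split.
  - by exists X => //; have [_ []] := FP _ FX u Xu.
  - move=> x y x' y' [X1 FX1 X1x] [X2 FX2 X2x].
    have [X12|X21] := Ftot _ _ FX1 FX2.
    + by exists X2 => //; have [_ [_ XB _]] := FP _ FX2 _ X2x; apply: XB => //; exact: X12.
    + by exists X1 => //; have [_ [_ XB _]] := FP _ FX1 _ X1x; apply: XB => //; exact: X21.
  - by move=> d [X1 FX1 X1d]; have [_ [_ _]] := FP _ FX1 _ X1d; apply.
have [S0 _ _] := pS.
have [SA pA] : good A.
  have [[u Au]|nA] := EM (exists u, A u); first exact: PA Au.
  exfalso; apply: (Amax S); last by move=> u _; split.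
  by split=> [u Au|SA]; [case: nA; exists u|apply: nA; exists (0, 0); exact: SA].
have [_ AB Af] := pA.
have Atot x : exists d, A (x, d).
  apply: contrapT => nx; have [|A' [d [pA' AA' A'x _]]] := partial_character_step (b := x) pA.
    by move=> d Ad; apply: nx; exists d.
  apply: (Amax A').
    by split=> // A'A; apply: nx; exists d; exact: A'A.
  by move=> u _; split=> //; exact: subset_trans SA AA'.
have Afun x d e : A (x, d) -> A (x, e) -> d = e.
  by move=> Ad Ae; apply/eqP; rewrite -subr_eq0; apply/eqP/Af; rewrite -(subrr x); exact: AB.
have [chi chiA] := choice Atot.
have chiP : zmod_morphism chi by move=> x y; apply: Afun (chiA _) _; exact: AB.
by exists (char_of chiP) => x d /SA; exact: Afun.
Qed.

(** One step from the zero graph takes a nonzero value at [a]; the result then extends to all of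
    [M]. *)
Lemma character_separates (a : M) : a <> 0 -> exists chi : character M, chi a <> 0.
Proof.
move=> a0.
have p0 : partial_character [set (0, 0)]%classic.
  by split=> [|x y x' y' [-> ->] [-> ->]|d [->]] //; rewrite /set1/= !subr0.
have [|S [d [/partial_character_total[chi chiS] _ Sad /eqP d0]]] :=
  partial_character_step (b := a) p0.
  by move=> d [].
by exists chi; rewrite (chiS _ _ Sad).
Qed.

End CharacterExtension.

Lemma character_extends (M N : zmodType) (f : {additive M -> N}) (chi : character M) :
  injective f -> exists chi' : character N, forall x, chi' (f x) = chi x.
Proof.
move=> fI; pose S : set (N * QmodZ) := fun u => exists x, u = (f x, chi x).
have [|chi' chiE] := @partial_character_total _ S; last first.
  by exists chi' => x; apply: chiE; exists x.
split=> [|_ _ _ _ [x [-> ->]] [y [-> ->]]|d [x [/esym fx0 ->]]].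
- by exists 0; rewrite !raddf0.
- by exists (x - y); rewrite !raddfB.
- by rewrite (_ : x = 0) ?raddf0//; apply: fI; rewrite fx0 raddf0.
Qed.

(** * Constructions of modules *)

(** The module laws are asked only up to [e], so [T] may consist of raw terms. The carrier is the
    set of fixed points of a choice [c] of representatives. *)
Lemma setoid_module (R : pzRingType) (T : Type) (e : T -> T -> Prop)
    (z : T) (add : T -> T -> T) (scale : R -> T -> T) :
  (forall x, e x x) -> (forall x y, e x y -> e y x) ->
  (forall x y t, e x y -> e y t -> e x t) ->
  (forall x x' y y', e x x' -> e y y' -> e (add x y) (add x' y')) ->
  (forall a x x', e x x' -> e (scale a x) (scale a x')) ->
  (forall x y t, e (add x (add y t)) (add (add x y) t)) ->
  (forall x y, e (add x y) (add y x)) ->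
  (forall x, e (add z x) x) ->
  (forall x, e (add (scale (-1) x) x) z) ->
  (forall a b x, e (scale a (scale b x)) (scale (a * b) x)) ->
  (forall x, e (scale 1 x) x) ->
  (forall a x y, e (scale a (add x y)) (add (scale a x) (scale a y))) ->
  (forall x a b, e (scale (a + b) x) (add (scale a x) (scale b x))) ->
  exists (Q : lmodType R) (pi : T -> Q),
    [/\ surj pi, forall x y, pi x = pi y <-> e x y,
        forall x y, pi (add x y) = pi x + pi y
      & forall a x, pi (scale a x) = a *: pi x].
Proof.
move=> exx eS eT eadd escale addA addC add0 addN scA sc1 scDr scDl.
have [c cP] : {c : T -> T & forall x, e x (c x) /\ forall y, e x y -> c x = c y}.
  pose c x := sval (cid (ex_intro (e x) x (exx x))).
  exists c => x; split; first exact: svalP (cid (ex_intro (e x) x (exx x))).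
  move=> y exy; rewrite /c.
  (* Equivalent elements define the same predicate, and proof irrelevance then makes the chosen
     witnesses equal. *)
  have E : e x = e y.
    by apply/funext => t; apply/propext; split; apply: eT => //; exact: eS.
  by case: _ / E (ex_intro _ x _) (ex_intro _ y _) => p q; rewrite (Prop_irrelevance p q).
pose Q0 := {x : T | c x = x}.
have ccK x : c (c x) = c x by apply/esym/(cP x).2/(cP x).1.
pose p x : Q0 := exist _ (c x) (ccK x).
have pP x y : p x = p y <-> e x y.
  split=> [[cxy]|/(cP x).2 cxy]; last by rewrite /p; exact: eq_exist.
  by apply: (eT _ _ _ (cP x).1 _); rewrite cxy; apply: eS; exact: (cP y).1.
have pS x y : e x y -> p x = p y by move/pP.
have pK (q : Q0) : p (sval q) = q by case: q => x cx; exact: eq_exist.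
have eK x : e (sval (p x)) x by apply/pP/pK.
pose Qc := HB.pack_for choiceType Q0 (gen_eqMixin Q0) (gen_choiceMixin Q0).
pose qadd (x y : Qc) : Qc := p (add (sval x) (sval y)).
pose qopp (x : Qc) : Qc := p (scale (-1) (sval x)).
have qA : associative qadd.
  move=> x y t; apply: pS; apply: (eT _ _ _ (_ : e _ (add (sval x) (add (sval y) (sval t)))) _).
    by apply: eadd => //; exact: eK.
  by apply: (eT _ _ _ (addA _ _ _) _); apply: eadd => //; apply: eS; exact: eK.
have qC : commutative qadd by move=> x y; exact: pS.
have q0 : left_id (p z) qadd.
  move=> x; apply: (eq_trans _ (pK x)); apply: pS; apply: (eT _ _ _ _ (add0 _)).
  by apply: eadd => //; exact: eK.
have qN : left_inverse (p z) qopp qadd.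
  by move=> x; apply: pS; apply: (eT _ _ _ _ (addN (sval x))); apply: eadd => //; exact: eK.
pose Qz := HB.pack_for zmodType Qc (GRing.isZmodule.Build Qc qA qC q0 qN).
pose qsc (a : R) (x : Qz) : Qz := p (scale a (sval x)).
have qscA a b x : qsc a (qsc b x) = qsc (a * b) x.
  by apply: pS; apply: (eT _ _ _ _ (scA _ _ _)); apply: escale; exact: eK.
have qsc1 : left_id 1 qsc by move=> x; apply: (eq_trans _ (pK x)); exact: pS.
have qscDr : right_distributive qsc +%R.
  move=> a x y; apply: pS; apply: (eT _ _ _ (_ : e _ (scale a (add (sval x) (sval y)))) _).
    by apply: escale; exact: eK.
  by apply: (eT _ _ _ (scDr _ _ _) _); apply: eadd; apply: eS; exact: eK.
have qscDl x : {morph qsc^~ x : a b / a + b}.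
  move=> a b; apply: pS; apply: (eT _ _ _ (scDl _ _ _) _).
  by apply: eadd; apply: eS; exact: eK.
pose Q := HB.pack_for (lmodType R) Qz
  (GRing.Zmodule_isLmodule.Build R Qz qscA qsc1 qscDr qscDl).
exists Q, p; split=> // [q|x y|a x]; first by exists (sval q).
  by apply: pS; apply: eadd; apply: eS; exact: eK.
by apply: pS; apply: escale; apply: eS; exact: eK.
Qed.

Section Linear.
Variable R : pzRingType.

Lemma linear_of (U V : lmodType R) (f : U -> V) :
  (forall x y, f (x + y) = f x + f y) -> (forall a x, f (a *: x) = a *: f x) ->
  exists g : {linear U -> V}, g =1 f.
Proof.
move=> fD fZ.
have fL : linear f by move=> a x y; rewrite fD fZ.
by exists (HB.pack_for {linear U -> V} f (GRing.isLinear.Build R U V _ f fL)).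
Qed.

(** The relation [g d^-1 b] is single-valued because [g] kills the kernel of [d]. With [b] or [g]
    the identity it gives factorisation through a surjection or an injection. *)
Lemma relational_factor (Y Z N K : lmodType R) (d : {linear Y -> Z})
    (g : {linear Y -> N}) (b : {linear K -> Z}) :
  (forall y, d y = 0 -> g y = 0) -> (forall x, exists y, d y = b x) ->
  exists u : {linear K -> N}, forall x y, d y = b x -> u x = g y.
Proof.
move=> dg /choice[c cP].
have gc x y : d y = b x -> g (c x) = g y.
  by move=> dy; apply/eqP; rewrite -subr_eq0 -linearB dg// linearB cP dy subrr.
have [u uE] : exists u : {linear K -> N}, u =1 g \o c.
  apply: linear_of => [x y|a x] /=.
    by rewrite -linearD; apply: gc; rewrite !linearD !cP.
  by rewrite -linearZ; apply: gc; rewrite !linearZ cP.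
by exists u => x y dy; rewrite uE /= (gc _ _ dy).
Qed.

Lemma factor_inj (A B C : lmodType R) (f : {linear A -> B}) (d : {linear C -> B}) :
  injective f -> (forall x, exists y, f y = d x) ->
  exists u : {linear C -> A}, forall x, f (u x) = d x.
Proof.
move=> fI fd; have [y|u uP] := @relational_factor _ _ _ _ f idfun d _ fd.
  by move=> fy0; apply: fI; rewrite fy0 linear0.
by exists u => x; have [y fy] := fd x; rewrite (uP _ _ fy).
Qed.

Lemma factor_surj (B C N : lmodType R) (g : {linear B -> C}) (k : {linear B -> N}) :
  surj g -> (forall y, g y = 0 -> k y = 0) ->
  exists u : {linear C -> N}, forall y, u (g y) = k y.
Proof.
move=> gS gk; have [u uP] := @relational_factor _ _ _ _ g k idfun gk gS.
by exists u => y; exact: uP.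
Qed.


(* Terms are identified when all the interpretations [v i] agree; [I] may be large,
   so that the interpretations can range over all models of a theory. *)
Lemma semantic_module (T : Type) (z : T) (add : T -> T -> T) (scale : R -> T -> T)
    (I : Type) (N : I -> lmodType R) (v : forall i, T -> N i) :
  (forall i, v i z = 0) -> (forall i x y, v i (add x y) = v i x + v i y) ->
  (forall i a x, v i (scale a x) = a *: v i x) ->
  exists (Q : lmodType R) (pi : T -> Q),
    [/\ surj pi, pi z = 0, forall x y, pi (add x y) = pi x + pi y,
        forall a x, pi (scale a x) = a *: pi x
      & (forall x y, (forall i, v i x = v i y) -> pi x = pi y) /\
        (forall i, exists h : {linear Q -> N i}, forall x, h (pi x) = v i x)].
Proof.
move=> v0 vD vZ.
have [|||||||||||||Q [pi [piS piP piD piZ]]] :=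
  @setoid_module R T (fun x y => forall i, v i x = v i y) z add scale => //.
- by move=> x y t xy yt i; rewrite xy.
- by move=> x x' y y' xx yy i; rewrite !vD xx yy.
- by move=> a x x' xx i; rewrite !vZ xx.
- by move=> x y t i; rewrite !vD addrA.
- by move=> x y i; rewrite !vD addrC.
- by move=> x i; rewrite vD v0 add0r.
- by move=> x i; rewrite vD vZ v0 scaleN1r addNr.
- by move=> a b x i; rewrite !vZ scalerA.
- by move=> x i; rewrite vZ scale1r.
- by move=> a x y i; rewrite vZ !vD !vZ scalerDr.
- by move=> x a b i; rewrite vD !vZ scalerDl.
exists Q, pi; split=> //.
  by rewrite -(scale0r (pi z)) -piZ; apply/piP => i; rewrite vZ scale0r v0.
split=> [x y xy|i]; first exact/piP.
have [c cK] := choice piS.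
have vc x : v i (c (pi x)) = v i x by apply: (piP _ _).1; rewrite cK.
have [h hE] : exists h : {linear Q -> N i}, h =1 v i \o c.
  apply: linear_of => [x y|a x] /=.
    by rewrite -{1}(cK x) -{1}(cK y) -piD vc vD.
  by rewrite -{1}(cK x) -piZ vc vZ.
by exists h => x; rewrite hE /= vc.
Qed.

Lemma kernel_exists (A B : lmodType R) (f : {linear A -> B}) :
  exists (K : lmodType R) (k : {linear K -> A}), injective k /\ exact_at k f.
Proof.
pose T := {x : A | f x = 0}.
pose z : T := exist _ 0 (linear0 f).
have addP (x y : T) : f (sval x + sval y) = 0.
  by rewrite linearD (svalP x) (svalP y) addr0.
have scP a (x : T) : f (a *: sval x) = 0 by rewrite linearZ_LR (svalP x) scaler0.
have [//|//|//|K [pi [piS _ _ _ [piP /(_ tt)[k kE]]]]] :=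
  @semantic_module T z (fun x y => exist _ _ (addP x y))
    (fun a x => exist _ _ (scP a x)) unit (fun=> A) (fun=> sval).
exists K, k; split=> [x y|x].
  have [{}x <-] := piS x; have [{}y <-] := piS y.
  by rewrite !kE => xy; apply: piP.
split=> [fx|[y <-]]; first by exists (pi (exist _ x fx)); rewrite kE.
by have [{}y <-] := piS y; rewrite kE; exact: (svalP y).
Qed.

Lemma cokernel_exists (A B : lmodType R) (f : {linear A -> B}) :
  exists (C : lmodType R) (c : {linear B -> C}), surj c /\ exact_at f c.
Proof.
pose e (x y : B) := exists a, f a = x - y.
have [|||||||||||||C [pi [piS piP piD piZ]]] :=
  @setoid_module R B e 0 +%R *:%R.
- by move=> x; exists 0; rewrite linear0 subrr.
- by move=> x y [a fa]; exists (- a); rewrite linearN fa opprB.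
- by move=> x y t [a fa] [b fb]; exists (a + b); rewrite linearD fa fb addrA subrK.
- move=> x x' y y' [a fa] [b fb]; exists (a + b).
  by rewrite linearD fa fb opprD addrACA.
- by move=> r x x' [a fa]; exists (r *: a); rewrite linearZ_LR fa scalerBr.
- by move=> x y t; exists 0; rewrite linear0 addrA subrr.
- by move=> x y; exists 0; rewrite linear0 (addrC x) subrr.
- by move=> x; exists 0; rewrite linear0 add0r subrr.
- by move=> x; exists 0; rewrite linear0 scaleN1r addNr subrr.
- by move=> a b x; exists 0; rewrite linear0 scalerA subrr.
- by move=> x; exists 0; rewrite linear0 scale1r subrr.
- by move=> a x y; exists 0; rewrite linear0 scalerDr subrr.
- by move=> x a b; exists 0; rewrite linear0 scalerDl subrr.
have [c cE] := linear_of piD piZ.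
exists C, c; split=> [y|y]; first by have [x <-] := piS y; exists x; rewrite cE.
have <- : e y 0 <-> exists x, f x = y by rewrite /e subr0.
by rewrite -(linear0 c) !cE; exact: piP.
Qed.

(** * Free modules *)

Section FreeModule.
Variable X : Type.

Inductive lterm : Type :=
| LVar of X
| LZero
| LAdd of lterm & lterm
| LScale of R & lterm.

Fixpoint leval (N : lmodType R) (g : X -> N) (t : lterm) : N :=
  match t with
  | LVar x => g x
  | LZero => 0
  | LAdd s t => leval g s + leval g t
  | LScale a t => a *: leval g t
  end.

Lemma free_module_exists : exists (F : lmodType R) (v : X -> F),
  forall (N : lmodType R) (g : X -> N),
    exists2 h : {linear F -> N}, forall x, h (v x) = g x &
      forall h' : {linear F -> N}, (forall x, h' (v x) = g x) -> h' =1 h.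
Proof.
have [//|//|//|F [pi [piS pi0 piD piZ [_ piE]]]] :=
  @semantic_module lterm LZero LAdd LScale {N : lmodType R & X -> N}
    (fun i => projT1 i) (fun i => leval (projT2 i)).
exists F, (fun x => pi (LVar x)) => N g.
have [h hE] := piE (existT _ N g); exists h => [x|h' h'E y]; first by rewrite hE.
have [t <-] := piS y; rewrite hE /=.
elim: t => [x||s IHs t IHt|a t IHt] /=; first exact: h'E.
- by rewrite pi0 linear0.
- by rewrite piD linearD IHs IHt.
- by rewrite piZ linearZ_LR IHt.
Qed.

End FreeModule.

Lemma free_cover (M : lmodType R) : exists (F : lmodType R) (g : {linear F -> M}),
  [/\ surj g, projective F
    & forall L : lmodType R -> Prop, L R^o -> coproduct_closed L -> L F].
Proof.
have [F [v vP]] := free_module_exists M.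
have [g gE _] := vP M id.
exists F, g; split=> [x|A B p f pS|L LR Lco]; first by exists (v x).
  have [c cK] := choice pS.
  have [h hE _] := vP A (fun x => c (f (v x))); exists h => y.
  have [k kE kU] := vP B (fun x => f (v x)).
  rewrite (kU f)// -(kU (p \o h))// => x.
  by rewrite /= hE cK.
have [inj injE] : exists inj : M -> {linear R^o -> F}, forall x a, inj x a = (a : R) *: v x.
  suff /choice[inj injE] x : exists i : {linear R^o -> F}, i =1 (fun a : R => a *: v x).
    by exists inj => x a; exact: injE.
  by apply: linear_of => [a b|a b] /=; rewrite ?scalerDl// scalerA.
(* [F] is the coproduct of copies of R indexed by the elements of [M], since a map out of R is given
   by its value at 1. *)
apply: (Lco M (fun=> R^o) F inj) => // N h.
have [k kE kU] := vP N (fun x => h x 1); exists k => [x a|h' h'E].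
  by rewrite injE linearZ_LR kE -linearZ_LR /= [_ *: _]mulr1.
by apply: kU => x; rewrite -h'E injE scale1r.
Qed.

(** * Vanishing of Ext^1 *)

Lemma syzygy_exists (A B : lmodType R) (d : {linear B -> A}) :
  exists (F : lmodType R) (d' : {linear F -> B}), projective F /\ exact_at d' d.
Proof.
have [K [k [kI kE]]] := kernel_exists d; have [F [g [gS Fp _]]] := free_cover K.
exists F, (k \o g); split=> // y; split=> [/kE[x <-]|[x <-]].
  by have [t <-] := gS x; exists t.
by apply/kE; exists (g x).
Qed.

(** [Ext1_eq0] speaks of entire resolutions, so a projective surjection has to be continued to one
    before the vanishing can be used. *)
Lemma projective_resolution_over (M F : lmodType R) (g : {linear F -> M}) :
  surj g -> projective F ->
  exists (F1 : lmodType R) (d : {linear F1 -> F}), exact_at d g /\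
    forall N : lmodType R, Ext1_eq0 M N -> forall k : {linear F1 -> N},
      (forall y, d y = 0 -> k y = 0) -> exists h : {linear F -> N}, forall x, h (d x) = k x.
Proof.
move=> gS Fp.
(* A stage is a map of modules; [next] passes to a map from a projective module onto its kernel, and
   iteration yields the resolution. *)
pose stage := {A : lmodType R & {B : lmodType R & {linear B -> A}}}.
pose obj (s : stage) := projT1 (projT2 s).
pose map (s : stage) : {linear obj s -> projT1 s} := projT2 (projT2 s).
have [F' F'P] := choice (fun s => syzygy_exists (map s)).
have [d' d'P] : {d' : forall s, {linear F' s -> obj s} &
    forall s, projective (F' s) /\ exact_at (d' s) (map s)}.
  exists (fun s => sval (cid (F'P s))) => s; exact: svalP (cid (F'P s)).
pose next (s : stage) : stage := existT _ (obj s) (existT _ (F' s) (d' s)).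
pose st n := iter n next (existT _ M (existT _ F g)).
have objP n : projective (obj (st n)) by case: n => [|n] //; case: (d'P (st n)).
have mapE n : exact_at (map (st n.+1)) (map (st n)) by case: (d'P (st n)).
pose P := @ProjectiveResolution R M (fun n => obj (st n)) (fun n => map (st n.+1))
  g objP gS (mapE 0) (fun n => mapE n.+1).
exists (P 1), (pr_diff P 0); split; first exact: mapE 0.
move=> N MN k kd; apply: (MN P) => x; apply: kd; apply/(mapE 1).
by exists x.
Qed.

Lemma Ext1_eq0_extend (K F M N : lmodType R) (j : {linear K -> F}) (g : {linear F -> M}) :
  short_exact j g -> projective F -> Ext1_eq0 M N ->
  forall k : {linear K -> N}, exists h : {linear F -> N}, forall x, h (j x) = k x.
Proof.
move=> [jI jE gS] Fp MN k.
have [F1 [d [dE dN]]] := projective_resolution_over gS Fp.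
have [u uE] : exists u : {linear F1 -> K}, forall x, j (u x) = d x.
  by apply: factor_inj => // x; apply/jE/dE; exists x.
have [|h hE] := dN N MN (k \o u).
  move=> y dy; have uy : u y = 0 by apply: jI; rewrite uE dy linear0.
  by rewrite /= uy linear0.
exists h => x; have /dE[y dy] : g (j x) = 0 by apply/jE; exists x.
by rewrite -dy hE /=; have <- : u y = x by apply: jI; rewrite uE.
Qed.

(** Comparison maps [al] and [be] between an arbitrary resolution and the given presentation
    transport the cocycle [q]. *)
Lemma extend_Ext1_eq0 (K F M N : lmodType R) (j : {linear K -> F}) (g : {linear F -> M}) :
  short_exact j g -> projective F ->
  (forall k : {linear K -> N}, exists h : {linear F -> N}, forall x, h (j x) = k x) ->
  Ext1_eq0 M N.
Proof.
move=> [jI jE gS] Fp ext P q qd.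
have [al alE] := @pr_projective _ _ P 0%N _ _ g (pr_aug P) gS.
have [be beE] := Fp _ _ (pr_aug P) g (@pr_aug_surj _ _ P).
have q0 y : pr_diff P 0 y = 0 -> q y = 0 by move=> /(@pr_diff_exact _ _ P 0%N)[x <-].
(* [e] carries the cocycle to [K] along [be]. Then [u] applies [q] to the homotopy between
   [be \o al] and the identity; subtracting it corrects the extension of [e]. *)
have [|e eE] := relational_factor (b := be \o j) q0.
  by move=> x; apply/(@pr_aug_exact _ _ P); rewrite beE; apply/jE; exists x.
have [|u uE] := relational_factor (b := (be \o al) \- idfun) q0.
  by move=> x; apply/(@pr_aug_exact _ _ P); rewrite /= linearB beE alE subrr.
have [h hE] := ext e.
exists ((h \o al) \- u) => x /=.
have /jE[t tE] : g (al (pr_diff P 0 x)) = 0.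
  by rewrite alE; apply/(@pr_aug_exact _ _ P); exists x.
have /(@pr_aug_exact _ _ P)[y yE] : pr_aug P (be (al (pr_diff P 0 x))) = 0.
  by rewrite beE -tE; apply/jE; exists t.
rewrite -tE hE (_ : e t = q y); last by apply: eE; rewrite /= yE tE.
rewrite (_ : u _ = q (y - x)); last by apply: uE; rewrite linearB /= yE.
by rewrite linearB opprB addrC subrK.
Qed.

(** Lift [g] through [p]: on [K] the lift lands in [N], and after subtracting an extension of that
    restriction to [F] it descends to [M]. *)
Lemma Ext1_eq0_section (M N E : lmodType R) (i : {linear N -> E}) (p : {linear E -> M}) :
  short_exact i p -> Ext1_eq0 M N -> exists s : {linear M -> E}, forall x, p (s x) = x.
Proof.
move=> [iI iE pS] MN.
have [F [g [gS Fp _]]] := free_cover M; have [K [j [jI jE]]] := kernel_exists g.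
have [l lE] := Fp _ _ p g pS.
have [|k kE] := factor_inj (d := l \o j) iI.
  by move=> x; apply/iE; rewrite /= lE; apply/jE; exists x.
have [h hE] := Ext1_eq0_extend (And3 jI jE gS) Fp MN k.
have pi0 x : p (i x) = 0 by apply/iE; exists x.
have [|s sE] := factor_surj (k := l \- (i \o h)) gS.
  by move=> y /jE[x <-] /=; rewrite hE kE subrr.
by exists s => x; have [y <-] := gS x; rewrite sE /= linearB lE pi0 subr0.
Qed.

Lemma section_retraction (M N E : lmodType R) (i : {linear N -> E}) (p : {linear E -> M})
    (s : {linear M -> E}) :
  short_exact i p -> (forall x, p (s x) = x) ->
  exists r : {linear E -> N}, forall x, r (i x) = x.
Proof.
move=> [iI iE _] ps.
have [|r rE] := factor_inj (d := idfun \- (s \o p)) iI.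
  by move=> x; apply/iE; rewrite /= linearB ps subrr.
exists r => x; apply: iI; have pix : p (i x) = 0 by apply/iE; exists x.
by rewrite rE /= pix linear0 subr0.
Qed.

Lemma Ext1_eq0_retraction (M N E : lmodType R) (i : {linear N -> E})
    (p : {linear E -> M}) :
  short_exact i p -> Ext1_eq0 M N -> exists r : {linear E -> N}, forall x, r (i x) = x.
Proof.
by move=> ip MN; have [s /section_retraction] := Ext1_eq0_section ip MN; apply.
Qed.

(** * Pushouts *)

Section Pushout.
Variables (K F N E : lmodType R).
Variables (j : {linear K -> F}) (k : {linear K -> N}).
Variables (a : {linear N -> E}) (b : {linear F -> E}).

(** Says on elements that [E] is the sum of [N] and [F] modulo the antidiagonal image of [K]. The
    conditions are symmetric in the two legs, so one lemma gives exactness of both rows and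
    columns. *)
Definition pushout_square : Prop :=
  [/\ forall x, a (k x) = b (j x), forall e, exists n x, e = a n + b x
    & forall n x, a n + b x = 0 -> exists y, n = k y /\ x = - j y].

Lemma pushout_short_exact (M : lmodType R) (g : {linear F -> M}) :
  pushout_square -> short_exact j g ->
  exists p : {linear E -> M}, short_exact a p /\ forall x, p (b x) = g x.
Proof.
move=> [abE abS ab0] [jI jE gS].
have gj x : g (j x) = 0 by apply/jE; exists x.
have [c cE] : exists c : {linear (N * F)%type -> E}, c =1 fun u => a u.1 + b u.2.
  by apply: linear_of => [x y|r x] /=; rewrite ?linearD ?linearZ_LR ?scalerDr// addrACA.
have [|| p pE] := factor_surj (g := c) (k := g \o snd).
- by move=> e; have [n [x ->]] := abS e; exists (n, x); rewrite cE.
- by move=> [n x]; rewrite cE /= => /ab0[y [_ ->]]; rewrite linearN gj oppr0.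
have {}pE n x : p (a n + b x) = g x by have := pE (n, x); rewrite cE.
have pb x : p (b x) = g x by rewrite -(pE 0) linear0 add0r.
exists p; split=> //; split.
- apply: raddf_inj => n an0.
  have [|y [-> y0]] := ab0 n 0; first by rewrite an0 linear0 addr0.
  by rewrite (_ : y = 0) ?linear0//; apply: jI; rewrite linear0 -[j y]opprK -y0 oppr0.
- move=> e; split=> [|[n <-]]; last by rewrite -[a n]addr0 -(linear0 b) pE linear0.
  have [n [x ->]] := abS e; rewrite pE => /jE[y <-].
  by exists (n + k y); rewrite linearD abE.
- by move=> m; have [x <-] := gS m; exists (b x).
Qed.

End Pushout.

Lemma pushout_exists (K F N : lmodType R) (j : {linear K -> F}) (k : {linear K -> N}) :
  exists (E : lmodType R) (a : {linear N -> E}) (b : {linear F -> E}),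
    pushout_square j k a b.
Proof.
have [f fE] : exists f : {linear K -> (N * F)%type}, f =1 fun x => (k x, - j x).
  apply: linear_of => [x y|r x] /=; first by rewrite !linearD.
  by rewrite !linearZ_LR; congr (_, _); exact: esym (scalerN _ _).
have [E [c [cS cE]]] := cokernel_exists f.
have [a aE] : exists a : {linear N -> E}, a =1 fun n => c (n, 0).
  apply: linear_of => [x y|r x] /=; first by rewrite -linearD; congr (c (_, _)); rewrite addr0.
  by rewrite -linearZ_LR; congr (c (_, _)); rewrite scaler0.
have [b bE] : exists b : {linear F -> E}, b =1 fun x => c (0, x).
  apply: linear_of => [x y|r x] /=; first by rewrite -linearD; congr (c (_, _)); rewrite addr0.
  by rewrite -linearZ_LR; congr (c (_, _)); rewrite scaler0.
have abE n x : a n + b x = c (n, x).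
  by rewrite aE bE -linearD; congr (c (_, _)); rewrite /= ?addr0 ?add0r.
exists E, a, b; split=> [x|e|n x].
- apply/eqP; rewrite -subr_eq0 -linearN abE; apply/eqP/cE.
  by exists x; rewrite fE.
- by have [[n x] <-] := cS e; exists n, x; rewrite abE.
- by rewrite abE => /cE[y]; rewrite fE => -[<- <-]; exists y.
Qed.

Lemma pushout_squareC (K F N E : lmodType R) (j : {linear K -> F})
    (k : {linear K -> N}) (a : {linear N -> E}) (b : {linear F -> E}) :
  pushout_square j k a b -> pushout_square k j b a.
Proof.
move=> [abE abS ab0]; split=> [x|e|x n].
- by rewrite abE.
- by have [n [x ->]] := abS e; exists x, n; rewrite addrC.
rewrite addrC => /ab0[y [-> ->]]; exists (- y).
by rewrite !linearN opprK.
Qed.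

(** The pushout of a free presentation of [M] along [k] is an extension of [M] by [N], and a
    splitting of it extends [k] to [F]. *)
Lemma section_Ext1_eq0 (M N : lmodType R) :
  (forall (E : lmodType R) (i : {linear N -> E}) (p : {linear E -> M}),
     short_exact i p -> exists s : {linear M -> E}, forall x, p (s x) = x) ->
  Ext1_eq0 M N.
Proof.
move=> split_ext.
have [F [g [gS Fp _]]] := free_cover M; have [K [j [jI jE]]] := kernel_exists g.
have jg : short_exact j g by [].
apply: (extend_Ext1_eq0 jg Fp) => k.
have [E [a [b po]]] := pushout_exists j k.
have [p [ap _]] := pushout_short_exact po jg.
have [s sE] := split_ext E a p ap.
have [r rE] := section_retraction ap sE.
by exists (r \o b) => x /=; case: po => <- _ _; rewrite rE.
Qed.

Lemma retraction_section (M N E : lmodType R) (i : {linear N -> E})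
    (p : {linear E -> M}) (r : {linear E -> N}) :
  short_exact i p -> (forall x, r (i x) = x) ->
  exists s : {linear M -> E}, forall x, p (s x) = x.
Proof.
move=> [iI iE pS] ri.
have [|s sE] := factor_surj (k := idfun \- (i \o r)) pS.
  by move=> y /iE[x <-] /=; rewrite ri subrr.
exists s => x; have [y <-] := pS x; rewrite sE /= linearB.
by rewrite (_ : p (i _) = 0) ?subr0//; apply/iE; exists (r y).
Qed.

Lemma projective_Ext1_eq0 (P N : lmodType R) : projective P -> Ext1_eq0 P N.
Proof. by move=> Pp; apply: section_Ext1_eq0 => E i p [_ _ /(Pp _ _ p idfun)]. Qed.

(** Given an extension [E] of [Z] by [N], projectivity lifts [P] to [E]. Modulo this lift, [E]
    becomes an extension of [X] by [N], whose retraction gives one for [E]. *)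
Lemma Ext1_eq0_extension_projective (P Z X N : lmodType R) (u : {linear P -> Z})
    (v : {linear Z -> X}) :
  short_exact u v -> projective P -> Ext1_eq0 X N -> Ext1_eq0 Z N.
Proof.
move=> [uI uE vS] Pp XN; apply: section_Ext1_eq0 => E i p ip.
have [iI iE pS] := ip.
have [l lE] := Pp _ _ p u pS.
have [C [c [cS cE]]] := cokernel_exists l.
have [|q qE] := factor_surj (k := v \o p) cS.
  by move=> _ /cE[x <-] /=; rewrite lE; apply/uE; exists x.
have ciq : short_exact (c \o i) q.
  split=> [|y|x].
  - apply: raddf_inj => n /cE[x xE]; apply: iI.
    have x0 : x = 0 by apply: uI; rewrite linear0 -lE xE; apply/iE; exists n.
    by rewrite -xE x0 !linear0.
  - split=> [|[n <-]] /=; last first.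
      by rewrite qE /= (_ : p (i n) = 0) ?linear0//; apply/iE; exists n.
    have [e <-] := cS y; rewrite qE => /uE[x xE].
    have /iE[n nE] : p (e - l x) = 0 by rewrite linearB lE xE subrr.
    exists n; rewrite nE linearB (_ : c (l x) = 0) ?subr0//.
    by apply/cE; exists x.
  - by have [z <-] := vS x; have [e <-] := pS z; exists (c e); rewrite qE.
have [r rE] := Ext1_eq0_retraction ciq XN.
exact: (retraction_section (r := r \o c) ip rE).
Qed.

(** * The orthogonal of G *)

Section Periodic.
Variables (G P : lmodType R) (i : {linear G -> P}) (p : {linear P -> G}).
Hypotheses (ip : short_exact i p) (Pp : projective P).

Lemma orth1E (N : lmodType R) :
  orth1 G N <->
  forall k : {linear G -> N}, exists h : {linear P -> N}, forall x, h (i x) = k x.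
Proof.
by split=> [GN|]; [exact: Ext1_eq0_extend ip Pp GN|exact: extend_Ext1_eq0 ip Pp].
Qed.

(** A lift [l] of [e] to [B] differs from [k] on [G] by a map into [A], which extends to [P] and
    corrects [l]. *)
Lemma orth1_extend_over (A B C : lmodType R) (f : {linear A -> B}) (g : {linear B -> C})
    (k : {linear G -> B}) (e : {linear P -> C}) :
  short_exact f g -> orth1 G A -> (forall x, e (i x) = g (k x)) ->
  exists h : {linear P -> B}, (forall x, h (i x) = k x) /\ forall x, g (h x) = e x.
Proof.
move=> [fI fE gS] /orth1E GA eik.
have [l lE] := Pp e gS.
have [|a aE] := factor_inj (d := k \- (l \o i)) fI.
  by move=> x; apply/fE; rewrite /= linearB lE eik subrr.
have [b bE] := GA a.
exists (l \+ (f \o b)); split=> x /=; first by rewrite bE aE /= addrC subrK.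
by rewrite linearD lE (_ : g (f _) = 0) ?addr0//; apply/fE; exists (b x).
Qed.

Lemma orth1_thick : thick (orth1 G).
Proof.
have [iI iE pS] := ip.
have pi0 x : p (i x) = 0 by apply/iE; exists x.
split.
- move=> M A B [f [f' fK f'K]] /orth1E GM; apply/orth1E => k.
  have [inl inlE] : exists u : {linear A -> (A * B)%type}, u =1 fun x => (x, 0).
    apply: linear_of => [x y|r x]; congr (_, _); first by rewrite addr0.
    by rewrite scaler0.
  have [|s sE] := factor_inj (d := inl) (can_inj fK).
    by move=> x; exists (f' (inl x)).
  have [h hE] := GM (s \o k); exists (fst \o (f \o h)) => x.
  by rewrite /= hE /= sE inlE.
- move=> A B C f g fg GA GC; apply/orth1E => k.
  have [e eE] := (orth1E C).1 GC (g \o k).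
  by have [h [hE _]] := orth1_extend_over fg GA eE; exists h.
- move=> A B C f g [fI fE gS] /orth1E GB /orth1E GC; apply/orth1E => k.
  have gf x : g (f x) = 0 by apply/fE; exists x.
  have [e eE] := GB (f \o k).
  (* [g \o e] vanishes on the image of [i], so it factors through [p]. Extending the factor [c] to
     [P] and lifting to [B] gives a correction that moves [e] into [A] and vanishes on the image of
     [i], as [p \o i] is zero. *)
  have [|c cE] := factor_surj (k := g \o e) pS.
    by move=> y /iE[x <-]; rewrite /= eE gf.
  have [c1 c1E] := GC c; have [c2 c2E] := Pp c1 gS.
  have [|h hE] := factor_inj (d := e \- (c2 \o (i \o p))) fI.
    by move=> x; apply/fE; rewrite /= linearB c2E c1E cE subrr.
  exists h => x; apply: fI.
  by rewrite hE /= eE pi0 (linear0 i) (linear0 c2) subr0.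
- move=> A B C f g [fI fE gS] /orth1E GA /orth1E GB; apply/orth1E => k.
  (* Dimension shift: the obstruction to lifting [k] through [g] is the map [a : G -> A]. It extends
     to [P], so [k] lifts to [m : G -> B], which extends to [P] in turn. *)
  have [l lE] := Pp (k \o p) gS.
  have [|a aE] := factor_inj (d := l \o i) fI.
    by move=> x; apply/fE; rewrite /= lE /= pi0 linear0.
  have [a1 a1E] := GA a.
  have [|m mE] := factor_surj (k := l \- (f \o a1)) pS.
    by move=> y /iE[x <-]; rewrite /= a1E aE subrr.
  have [m1 m1E] := GB m; exists (g \o m1) => x.
  have [y <-] := pS x; rewrite /= m1E mE /= linearB lE /=.
  by rewrite (_ : g (f _) = 0) ?subr0//; apply/fE; exists (a1 y).
Qed.

(* [op] is applied to arbitrary functions, so that it makes sense on terms, but it is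
   only constrained on the linear ones. *)
Definition extension_op (N : lmodType R) (op : (G -> N) -> P -> N) : Prop :=
  forall k : {linear G -> N}, exists h : {linear P -> N},
    op k =1 h /\ forall x, h (i x) = k x.

Record extension_algebra := ExtensionAlgebra {
  algebra_module :> lmodType R;
  algebra_op : (G -> algebra_module) -> P -> algebra_module;
  algebra_opP : extension_op algebra_op
}.

Lemma orth1_extension_algebra (N : extension_algebra) : orth1 G N.
Proof. by apply/orth1E => k; have [h []] := algebra_opP k; exists h. Qed.

Lemma extension_op_exists (N : lmodType R) :
  orth1 G N -> exists op, @extension_op N op.
Proof.
move=> /orth1E GN.
suff /choice[op opP] : forall k : G -> N, exists o : P -> N,
    forall k' : {linear G -> N}, k' = k :> (G -> N) ->
    exists h : {linear P -> N}, o =1 h /\ forall x, h (i x) = k' x.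
  by exists op => k; exact: opP.
move=> k; have [[k' <-]|nk] := EM (exists k' : {linear G -> N}, k' = k :> (G -> N)).
  by have [h hE] := GN k'; exists h => k'' kk; exists h; split=> // x; rewrite kk.
by exists (fun=> 0) => k' kk; case: nk; exists k'.
Qed.

Lemma extension_op_over (N B : lmodType R) (Y : extension_algebra)
    (a : {linear N -> B}) (w : {linear B -> Y}) :
  short_exact a w -> orth1 G N ->
  exists2 op, @extension_op B op & forall k x, w (op k x) = algebra_op (w \o k) x.
Proof.
move=> aw GN; have [_ _ wS] := aw.
suff /choice[op opP] : forall k : G -> B, exists o : P -> B,
    (forall x, w (o x) = algebra_op (w \o k) x) /\
    forall k' : {linear G -> B}, k' = k :> (G -> B) ->
    exists h : {linear P -> B}, o =1 h /\ forall x, h (i x) = k' x.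
  by exists op => [k|k x]; [exact: (opP k).2|exact: (opP k).1].
move=> k; have [[k' <-]|nk] := EM (exists k' : {linear G -> B}, k' = k :> (G -> B)).
  have [e [opE eE]] := algebra_opP (w \o k').
  have [h [hE wh]] := orth1_extend_over aw GN eE.
  exists h; split=> [x|k'' kk]; first by rewrite wh -opE.
  by exists h; split=> // x; rewrite hE kk.
(* Compatibility with [w] is required for all functions, so a nonlinear [k] receives pointwise
   preimages under [w]. *)
have [o oE] := choice (fun x => wS (algebra_op (w \o k) x)).
by exists o; split=> // k' kk; case: nk; exists k'.
Qed.

(** * The free extension algebra on a module *)

Section FreeAlgebra.
Variable A : lmodType R.

Inductive eterm : Type :=
| EVar of A
| EZero
| EAdd of eterm & eterm
| EScale of R & eterm
| EExt of (G -> eterm) & P.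

Fixpoint eeval (N : extension_algebra) (f : A -> N) (t : eterm) : N :=
  match t with
  | EVar a => f a
  | EZero => 0
  | EAdd s t => eeval f s + eeval f t
  | EScale r t => r *: eeval f t
  | EExt k x => algebra_op (fun y => eeval f (k y)) x
  end.

Definition algebra_morphism (M N : extension_algebra) (h : M -> N) : Prop :=
  forall k x, h (algebra_op k x) = algebra_op (h \o k) x.

Lemma free_extension_algebra :
  exists (Y : extension_algebra) (j : {linear A -> Y}),
    forall (N : extension_algebra) (f : {linear A -> N}),
      exists h : {linear Y -> N},
        [/\ forall a, h (j a) = f a, algebra_morphism h
          & forall h' : {linear Y -> N}, (forall a, h' (j a) = f a) ->
              algebra_morphism h' -> h' =1 h].
Proof.
have [//|//|//|Y [pi [piS pi0 piD piZ [piE piv]]]] :=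
  @semantic_module eterm EZero EAdd EScale
    {N : extension_algebra & {linear A -> N}}
    (fun u => projT1 u) (fun u => eeval (projT2 u)).
have [c cK] := choice piS.
pose op (k : G -> Y) x : Y := pi (EExt (c \o k) x).
have opE (u : {N : extension_algebra & {linear A -> N}})
    (h : {linear Y -> projT1 u}) (hE : forall t, h (pi t) = eeval (projT2 u) t) k x :
    h (op k x) = algebra_op (h \o k) x.
  by rewrite hE /=; congr algebra_op; apply: funext => y; rewrite -hE cK.
have opP (k : {linear G -> Y}) :
    exists h : {linear P -> Y}, op k =1 h /\ forall x, h (i x) = k x.
  (* Linearity of [op k] and the extension equation hold under every interpretation, because [k]
     stays linear there; hence they hold in [Y]. *)
  have [h hE] : exists h : {linear P -> Y}, h =1 op k.
    apply: linear_of => [x y|r x].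
    - rewrite -piD; apply: piE => u; have [h hE] := piv u.
      rewrite -!hE piD linearD !(opE u h hE).
      by have [l [lE _]] := algebra_opP (h \o k); rewrite !lE linearD.
    - rewrite -piZ; apply: piE => u; have [h hE] := piv u.
      rewrite -!hE piZ linearZ_LR !(opE u h hE).
      by have [l [lE _]] := algebra_opP (h \o k); rewrite !lE linearZ_LR.
  exists h; split=> [x|x]; first by rewrite hE.
  rewrite hE -[RHS]cK; apply: piE => u; have [g gE] := piv u.
  rewrite -!gE (opE u g gE) cK.
  by have [l [lE li]] := algebra_opP (g \o k); rewrite lE li.
pose Y' := ExtensionAlgebra opP.
have [j jE] : exists j : {linear A -> Y'}, j =1 pi \o EVar.
  apply: linear_of => [x y|r x] /=.
    by rewrite -piD; apply: piE => u /=; rewrite linearD.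
  by rewrite -piZ; apply: piE => u /=; rewrite linearZ_LR.
exists Y', j => N f; pose u := existT (fun N : extension_algebra => {linear A -> N}) N f.
have [h hE] := piv u; exists h; split=> [a|k x|h' h'j h'm y].
- by rewrite jE hE.
- exact: (opE u h hE).
have [t <-] := piS y.
elim: t => [a||s IHs t IHt|r t IHt|k IHk x].
- by rewrite [RHS]hE /= -h'j jE.
- by rewrite pi0 !linear0.
- by rewrite piD !linearD IHs IHt.
- by rewrite piZ !linearZ_LR IHt.
have -> : pi (EExt k x) = op (pi \o k) x.
  apply: piE => v; have [g gE] := piv v; rewrite -!gE (opE v g gE) gE /=.
  by congr algebra_op; apply: funext => y'; exact: esym (gE _).
rewrite (opE u h hE) (h'm _ _); congr algebra_op.
by apply: funext => y'; exact: IHk.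
Qed.

End FreeAlgebra.

Lemma special_preenvelope (A : lmodType R) :
  (forall a : A, a <> 0 -> exists (N : lmodType R) (f : {linear A -> N}),
     orth1 G N /\ f a <> 0) ->
  exists (Y X : lmodType R) (j : {linear A -> Y}) (c : {linear Y -> X}),
    [/\ short_exact j c, left_orth (orth1 G) X & orth1 G Y].
Proof.
move=> Asep.
have [Y [j jP]] := free_extension_algebra A.
have [X [c [cS cE]]] := cokernel_exists j.
have cj a : c (j a) = 0 by apply/cE; exists a.
exists Y, X, j, c; split; last exact: orth1_extension_algebra.
  split=> //; apply: raddf_inj => a ja; apply: contrapT => /Asep[N [f [GN]]]; apply.
  (* With an operation chosen on [N], the map [f] factors through [j], so [j a = 0] would force
     [f a = 0]. *)
  have [op opP] := extension_op_exists GN.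
  have [h [hE _ _]] := jP (ExtensionAlgebra opP) f.
  by rewrite -[LHS]hE ja linear0.
move=> N GN; apply: section_Ext1_eq0 => E a q [aI aE qS].
have [d dE] : exists d : {linear (E * Y)%type -> X}, d =1 fun u => q u.1 - c u.2.
  by exists ((q \o fst) \- (c \o snd)).
(* [B] is the pullback of [q] and [c]; its projection [w] to [Y] will be onto with kernel [N]. *)
have [B [b [bI bE]]] := kernel_exists d.
have qc x : q (b x).1 = c (b x).2.
  by apply/eqP; rewrite -subr_eq0 -dE; apply/eqP/bE; exists x.
have inB e y : q e = c y -> exists x, b x = (e, y).
  by move=> qe; apply/bE; rewrite dE qe subrr.
have [inl inlE] : exists u : {linear N -> (E * Y)%type}, u =1 fun n => (a n, 0).
  apply: linear_of => [x y|r x]; first by rewrite linearD; congr (_, _); rewrite addr0.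
  by rewrite linearZ_LR; congr (_, _); rewrite scaler0.
have [inr inrE] : exists u : {linear A -> (E * Y)%type}, u =1 fun x => (0, j x).
  apply: linear_of => [x y|r x]; first by rewrite linearD; congr (_, _); rewrite addr0.
  by rewrite linearZ_LR; congr (_, _); rewrite scaler0.
have [|n nE] := factor_inj (d := inl) bI.
  by move=> x; rewrite inlE; apply: inB; rewrite linear0; apply/aE; exists x.
have [|j' j'E] := factor_inj (d := inr) bI.
  by move=> x; rewrite inrE; apply: inB; rewrite linear0 cj.
pose w : {linear B -> Y} := snd \o b.
have nw : short_exact n w.
  split=> [x y nxy|x|y].
  - by apply: aI; have := congr1 b nxy; rewrite !nE !inlE => -[].
  - split=> [wx|[y <-]]; last by rewrite /w /= nE inlE.
    have /aE[y ay] : q (b x).1 = 0 by rewrite qc (_ : (b x).2 = 0) ?linear0.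
    by exists y; apply: bI; rewrite nE inlE ay -[in LHS]wx [RHS]surjective_pairing.
  - have [e ey] := qS (c y); have [x xE] := inB e y ey.
    by exists x; rewrite /w /= xE.
have [op opP wop] := extension_op_over nw GN.
have [h [hj hm _]] := jP (ExtensionAlgebra opP) j'.
have [id' [_ _ idU]] := jP Y j.
(* [w \o h] and the identity are both algebra endomorphisms of [Y] compatible with [j], so
   uniqueness identifies them. *)
have wh y : w (h y) = y.
  have wh' : w \o h =1 id'.
    apply: idU => [x|k x]; first by rewrite /= hj /w /= j'E inrE.
    exact: etrans (congr1 w (hm k x)) (wop _ _).
  by rewrite -[LHS]/((w \o h) y) wh' -[RHS]/(idfun y) (idU idfun).
(* The first component of [h] vanishes on the image of [j], because [j'] is zero there, so it
   descends to a map from [X] to [E]. *)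
have [|s sE] := factor_surj (k := fst \o (b \o h)) cS.
  by move=> _ /cE[x <-] /=; rewrite hj j'E inrE.
by exists s => x; have [y <-] := cS x; rewrite sE /= qc -[in RHS](wh y).
Qed.

(** * Separation by Hom_Z(R, Q/Z), and special approximations *)

Lemma orth1_char_right :
  (forall chi : character G, exists chi' : character P, forall x, chi' (i x) = chi x) ->
  orth1 G (char_right (R^c)^o : lmodType R).
Proof.
move=> ext; apply/orth1E => k.
(* Adjunction: evaluation at 1 turns [k] into a character of [G]; its extension [chi'] is turned
   back into the map sending [x] to [r |-> chi' (r x)]. *)
have chiP : zmod_morphism (fun x : G => (k x : character _) (1 : R)).
  by move=> x y; rewrite linearB.
have [chi' chiE] := ext (char_of chiP).
have hP x : zmod_morphism (fun r : R => chi' (r *: x)).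
  by move=> r s; rewrite scalerBl raddfB.
have [h hE] : exists h : {linear P -> char_right (R^c)^o},
    h =1 fun x => char_of (hP x) : char_right (R^c)^o.
  apply: linear_of => [x y|r x]; apply: val_inj; apply: funext => s /=.
    by rewrite scalerDr raddfD.
  by rewrite scalerA.
exists h => x; apply: val_inj; apply: funext => r.
rewrite hE /= -linearZ_LR chiE /= linearZ_LR /=.
by congr ((k x : character _) _); exact: (@mulr1 R^c r).
Qed.

Lemma char_right_separates (A : lmodType R) (chi : character A) (a : A) :
  chi a <> 0 -> exists f : {linear A -> char_right (R^c)^o}, f a <> 0.
Proof.
move=> chia.
have fP x : zmod_morphism (fun r : R => chi (r *: x)).
  by move=> r s; rewrite scalerBl raddfB.
have [f fE] : exists f : {linear A -> char_right (R^c)^o},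
    f =1 fun x => char_of (fP x) : char_right (R^c)^o.
  apply: linear_of => [x y|r x]; apply: val_inj; apply: funext => s /=.
    by rewrite scalerDr raddfD.
  by rewrite scalerA.
exists f => fa0; apply: chia.
by have := congr1 (fun u : character _ => u (1 : R)) fa0; rewrite fE /= scale1r.
Qed.

Lemma special_preenvelope_orth1 (A : lmodType R) :
  exists (Y X : lmodType R) (j : {linear A -> Y}) (c : {linear Y -> X}),
    [/\ short_exact j c, left_orth (orth1 G) X & orth1 G Y].
Proof.
apply: special_preenvelope => a /character_separates[chi].
move=> /char_right_separates[f fa]; exists (char_right (R^c)^o), f; split=> //.
by have [iI _ _] := ip; apply: orth1_char_right => chi'; exact: character_extends.
Qed.

(** In the pushout [E] of a free presentation of [A] along a special preenvelope of [K], the row is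
    [Y -> E -> A]; the column [F -> E -> X] puts [E] in the left orthogonal. *)
Lemma special_precover_orth1 (A : lmodType R) :
  exists (Y X : lmodType R) (f : {linear Y -> X}) (g : {linear X -> A}),
    [/\ short_exact f g, left_orth (orth1 G) X & orth1 G Y].
Proof.
have [F [g [gS Fp _]]] := free_cover A; have [K [j [jI jE]]] := kernel_exists g.
have [Y [X [u [c [uc Xo Yo]]]]] := special_preenvelope_orth1 K.
have [E [a [b po]]] := pushout_exists j u.
have [q [aq _]] := pushout_short_exact po (And3 jI jE gS).
have [v [bv _]] := pushout_short_exact (pushout_squareC po) uc.
exists Y, E, a, q; split=> // N GN.
exact: (Ext1_eq0_extension_projective bv Fp (Xo N GN)).
Qed.

Lemma orth1_cotorsion_pair : cotorsion_pair (left_orth (orth1 G)) (orth1 G).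
Proof.
split=> // N; split=> [GN|GN M]; first by apply: GN => N' GN'.
exact.
Qed.

(** For [M] in both classes, the kernel of a free cover lies in G^perp by thickness, so the cover
    splits and [M] inherits projectivity from [F]. *)
Lemma left_orth_orth1_projective (M : lmodType R) :
  (forall Q : lmodType R, projective Q -> orth1 G Q) ->
  left_orth (orth1 G) M /\ orth1 G M <-> projective M.
Proof.
move=> GP; split=> [[Mo GM]|Mp]; last first.
  by split=> [N _|]; [exact: projective_Ext1_eq0|exact: GP].
have [_ _ kerG _] := orth1_thick.
have [F [g [gS Fp _]]] := free_cover M; have [K [j [jI jE]]] := kernel_exists g.
have GK := kerG _ _ _ _ _ (And3 jI jE gS) (GP F Fp) GM.
have [s sE] := Ext1_eq0_section (And3 jI jE gS) (Mo K GK).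
move=> A B u f uS; have [h hE] := Fp _ _ u (f \o g) uS.
by exists (h \o s) => x; rewrite /= hE /= sE.
Qed.

End Periodic.

(** * Projectives, the class L and the theorem *)

Lemma projective_mem (L : lmodType R -> Prop) (Q : lmodType R) :
  L R^o -> coproduct_closed L -> summand_closed L -> projective Q -> L Q.
Proof.
move=> LR Lco Lsum Qp.
have [F [g [gS _ LF]]] := free_cover Q; have [K [j [jI jE]]] := kernel_exists g.
have [s sE] := Qp _ _ g idfun gS.
have [r rE] := section_retraction (And3 jI jE gS) sE.
have gj x : g (j x) = 0 by apply/jE; exists x.
apply: (Lsum F Q K); last exact: LF.
have [f fE] : exists f : {linear F -> (Q * K)%type}, f =1 fun x => (g x, r x).
  by apply: linear_of => [x y|a x]; rewrite ?linearD ?linearZ_LR.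
(* [r] is only known on the image of [j], hence the correction by [r (s u.1)]. *)
exists f; exists (fun u => s u.1 + j (u.2 - r (s u.1))) => [x|[x y]]; rewrite fE /=.
  have /jE[k kE] : g (x - s (g x)) = 0 by rewrite linearB sE subrr.
  by rewrite -linearB -kE rE kE addrC subrK.
by rewrite (linearD g) (linearD r) gj sE rE addr0 addrC subrK.
Qed.

(** [k \o p] vanishes on the image of [f], so Hom-exactness writes it as [h \o f]; then [h] extends
    [k] because [f] is [i \o p] and [p] is onto. *)
Lemma orth1_projective (L : lmodType R -> Prop) (G P : lmodType R)
    (f : {linear P -> P}) (i : {linear G -> P}) (p : {linear P -> G}) (Q : lmodType R) :
  short_exact i p -> projective P -> (forall x, i (p x) = f x) ->
  hom_exact_at f f Q -> orth1 G Q.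
Proof.
move=> ip Pp ipf fQ; have [iI iE pS] := ip; apply/(orth1E ip Pp) => k.
have pi0 x : p (i x) = 0 by apply/iE; exists x.
have [h hE] : exists h : {linear P -> Q}, forall y, h (f y) = (k \o p) y.
  by apply/fQ => x; rewrite -ipf /= pi0 linear0.
by exists h => x; have [y <-] := pS x; rewrite ipf hE.
Qed.

End Linear.

Theorem proposition4p4 (R : pzRingType)
    (L : lmodType R -> Prop) (A : lmodType R^c -> Prop)
    (hLA : complete_duality_pair L A)
    (G : lmodType R) (hG : strongly_Gorenstein_projective L G) :
  thick (orth1 G) /\
  (projective_cotorsion_pair (left_orth (orth1 G)) (orth1 G) /\
   cogenerated_by_set (left_orth (orth1 G)) (orth1 G)).
Proof.
(* Closure of [L] under summands comes from the second duality pair, in which [L] is the dual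
   class. *)
have [[[_ _ _ _ _] LR Lco _] [_ _ _ Lsum _]] := hLA.
have [P [f [Pp fE fL [i [iI iE]]]]] := hG.
(* [p] is [f] with codomain cut down to its image, which is its kernel [G]. *)
have [p pE] : exists p : {linear P -> G}, forall x, i (p x) = f x.
  by apply: factor_inj => // x; apply/iE/fE; exists x.
have ip : short_exact i p.
  split=> // [y|x]; last first.
    have /fE[y fy] : f (i x) = 0 by apply/iE; exists x.
    by exists y; apply: iI; rewrite pE.
  rewrite -(iE y) -pE; split=> [->|/eqP]; first by rewrite linear0.
  by rewrite -(linear0 i) => /eqP/iI.
have GP Q : projective Q -> orth1 G Q.
  by move=> Qp; apply: (orth1_projective L ip Pp pE); apply: fL; exact: projective_mem.
have thickG := orth1_thick ip Pp.
split=> //; split; last first.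
  split; first exact: orth1_cotorsion_pair.
  by exists unit, (fun=> G) => N; split=> [GN _|/(_ tt)].
split=> // [|M]; last exact: (left_orth_orth1_projective ip Pp M GP).
split=> [|M]; first exact: orth1_cotorsion_pair.
split; first exact: special_precover_orth1 ip Pp M.
by have [Y [X [j [c [jc Xo GY]]]]] := special_preenvelope_orth1 ip Pp M; exists Y, X, j, c.
Qed.
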